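(* There is no invariant bond percolation process on the square lattice $\mathbb{Z}^2$ which has more than two robust clusters (with positive probability).
   Context: $\mathbb{Z}^2$ denotes the square lattice graph, whose vertices are the integer points of the plane and whose edges join points at Euclidean distance $1$. An invariant bond percolation process on a graph $G$ is a random subset of the edge set of $G$ whose distribution is invariant under all graph automorphisms of $G$. The clusters of the process are the connected components of the random subgraph formed by the retained edges. A cluster $C$ is called robust if its critical percolation probability is strictly less than $1$, i.e. there is $\epsilon>0$ such that if each edge of $C$ is deleted independently with probability $\epsilon$, then with positive probability the remaining subgraph of $C$ still has an infinite connected component. *)

(* Defs.v *)
From HB Require Import structures.
From mathcomp Require Import all_boot all_order all_algebra.
From mathcomp Require Import all_classical all_reals.
From mathcomp Require Import measure probability.
From Stdlib Require Import Relation_Operators.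

Set Implicit Arguments.
Unset Strict Implicit.
Unset Printing Implicit Defensive.

Import Order.TTheory GRing.Theory Num.Theory.
Local Open Scope classical_set_scope.
Local Open Scope ring_scope.

Definition vertex := (int * int)%type.

Definition adj (x y : vertex) : bool :=
  `|x.1 - y.1| + `|x.2 - y.2| == 1 :> int.

(* Edges of Z^2, each represented exactly once:
   (v, false) is the edge {v, v + (1,0)}, (v, true) is the edge {v, v + (0,1)}. *)
Definition edge := (vertex * bool)%type.

Definition esrc (e : edge) : vertex := e.1.
Definition etgt (e : edge) : vertex :=
  if e.2 then (e.1.1, e.1.2 + 1) else (e.1.1 + 1, e.1.2).

(* The edge with endpoints {a, b} (meaningful when adj a b). *)
Definition edge_of (a b : vertex) : edge :=
  if b == (a.1 + 1, a.2) then (a, false)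
  else if a == (b.1 + 1, b.2) then (b, false)
  else if b == (a.1, a.2 + 1) then (a, true)
  else (b, true).

Definition automorphism (f : vertex -> vertex) : Prop :=
  bijective f /\ forall x y, adj (f x) (f y) = adj x y.

Definition edge_map (f : vertex -> vertex) (e : edge) : edge :=
  edge_of (f (esrc e)) (f (etgt e)).

Definition config := edge -> bool.

Definition F_adj (F : set edge) (x y : vertex) : Prop :=
  exists e, F e /\ ((esrc e = x /\ etgt e = y) \/ (esrc e = y /\ etgt e = x)).

Definition F_conn (F : set edge) : vertex -> vertex -> Prop :=
  clos_refl_trans vertex (F_adj F).

Definition open_edges (w : config) : set edge := [set e | w e].

Definition cluster (w : config) (x : vertex) : set vertex :=
  [set y | F_conn (open_edges w) x y].

(* Edges of the cluster C (retained edges with an endpoint, hence both, in C). *)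
Definition cluster_edges (w : config) (C : set vertex) : set edge :=
  [set e | w e /\ C (esrc e)].

Definition has_infinite_component (F : set edge) : Prop :=
  exists x, infinite_set [set y | F_conn F x y].

(* xi is a family of i.i.d. Bernoulli(eps) indicators indexed by the edges
   of Z^2, on the probability space (Om, Q): xi w e = true means that
   edge e is deleted, which happens with probability eps independently. *)
Definition iid_bernoulli (R : realType) (d : measure_display)
    (Om : measurableType d) (Q : probability Om R)
    (xi : Om -> edge -> bool) (eps : R) : Prop :=
  (forall e, measurable [set w | xi w e]) /\
  forall (s : seq edge) (b : edge -> bool), uniq s ->
    Q [set w | forall e, e \in s -> xi w e = b e] =
    ((\prod_(e <- s) (if b e then eps else 1 - eps))%:E)%E.

(* The subgraph with edge set F is robust: its critical probability is < 1,
   i.e. for some eps > 0, deleting each edge independently with probability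
   eps leaves an infinite component with positive probability. *)
Definition robust_edges (R : realType) (F : set edge) : Prop :=
  exists eps : R, 0 < eps <= 1 /\
    exists (d : measure_display) (Om : measurableType d)
           (Q : probability Om R) (xi : Om -> edge -> bool),
      iid_bernoulli Q xi eps /\
      exists B : set Om, measurable B /\
        B `<=` [set w | has_infinite_component
                          [set e | F e /\ xi w e = false]] /\
        (0 < Q B)%E.

Definition robust_cluster (R : realType) (w : config) (C : set vertex) : Prop :=
  robust_edges R (cluster_edges w C).

Definition more_than_two_robust (R : realType) (w : config) : Prop :=
  exists x y z : vertex,
    ~ F_conn (open_edges w) x y /\ ~ F_conn (open_edges w) x z /\
    ~ F_conn (open_edges w) y z /\
    robust_cluster R w (cluster w x) /\ robust_cluster R w (cluster w y) /\
    robust_cluster R w (cluster w z).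

Definition coord_events : set (set config) :=
  [set A | exists e, A = [set w : config | w e]].

Definition config_measurable (A : set config) : Prop :=
  <<s coord_events >> A.

Definition invariant_bond_percolation (R : realType) (d : measure_display)
    (Om : measurableType d) (P : probability Om R) (X : Om -> config) : Prop :=
  (forall e, measurable [set w | X w e]) /\
  forall f, automorphism f ->
    forall A, config_measurable A ->
      P (X @^-1` A) = P ((fun w => X w \o edge_map f) @^-1` A).

(* Main.v *)
(** Suppose that three robust clusters coexist with positive probability, and
    delete each edge independently with a small probability.  For a large
    enough box, with positive probability all edges touching the box are then
    closed, while its outer boundary meets three distinct clusters that still
    reach far away.  By invariance such good boxes have positive density, so a
    square of side n contains at least const * n^2 of them on average.  But the
    good boxes and the far-reaching clusters are the two sides of a planar
    simple bipartite graph in which every box has degree at least three, so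
    there are at most twice as many good boxes as clusters, and all these
    clusters meet the boundary of the square: there are O(n) of them.

    Planarity enters through the cycle space over F_2 (MacLane): every even
    edge set of the square lattice is the coboundary of a function on faces,
    so the cycle space of the bipartite graph is spanned by the boundaries of
    its regions.  Each edge bounds at most two regions and each nonzero
    boundary has at least four edges.

    Deletion only ever involves finitely many edges, so its expectation
    [thin_mean] is a finite sum and no infinite product measure is needed. *)

Require Import Defs.
From mathcomp Require Import all_boot all_order all_algebra.
From mathcomp Require Import all_classical all_reals.
From mathcomp Require Import numfun measure lebesgue_stieltjes_measure.
From mathcomp Require Import measurable_realfun lebesgue_integral probability.
From mathcomp Require Import ring lra zify.
From Stdlib Require Import Relation_Operators Operators_Properties.

Set Implicit Arguments.
Unset Strict Implicit.
Unset Printing Implicit Defensive.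

Import Order.TTheory GRing.Theory Num.Theory.
Local Open Scope ring_scope.

(** * Planar bipartite graphs in the square lattice *)

Lemma F2_addrr (x : 'F_2) : x + x = 0.
Proof. by apply: addrr_pchar2; exact: pchar_Fp. Qed.

Lemma F2_natb_add (a b : bool) : (a%:R + b%:R : 'F_2) = (a (+) b)%:R.
Proof. by case: a; case: b; rewrite ?F2_addrr ?addr0 ?add0r. Qed.

Definition incidence (v : vertex) (e : edge) : 'F_2 :=
  (v == esrc e)%:R + (v == etgt e)%:R.

Definition even_chain (s : seq edge) (y : edge -> 'F_2) :=
  forall v, \sum_(e <- s) y e * incidence v e = 0.

Lemma sum_seq_indic (T : eqType) (s : seq T) (x : T) (F : T -> 'F_2) :
  uniq s -> \sum_(z <- s) F z * (z == x)%:R = if x \in s then F x else 0.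
Proof.
move=> us; case: ifPn => xs.
  rewrite (bigD1_seq x) //= eqxx mulr1 big1 ?addr0 // => z /negbTE ->.
  by rewrite mulr0.
rewrite big_seq big1 // => z zs; case: eqP => [zx|_]; last by rewrite mulr0.
by rewrite -zx zs in xs.
Qed.

(** Summing the parity condition over the vertices of [K] counts each edge once per endpoint in
    [K]. *)
Lemma even_chain_cut (s : seq edge) (y : edge -> 'F_2) (K : pred vertex) :
  even_chain s y ->
  \sum_(e <- s) y e * ((K (esrc e))%:R + (K (etgt e))%:R) = 0.
Proof.
move=> ev; pose Vs := undup (map esrc s ++ map etgt s).
have uV : uniq Vs by exact: undup_uniq.
transitivity (\sum_(v <- Vs) (K v)%:R * \sum_(e <- s) y e * incidence v e).
  under [RHS]eq_bigr do rewrite big_distrr /=.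
  rewrite exchange_big /= big_seq [RHS]big_seq; apply: eq_bigr => e es.
  under eq_bigr => v _ do rewrite mulrCA mulrDr.
  rewrite -big_distrr /= big_split /= !sum_seq_indic // !mem_undup !mem_cat.
  by rewrite (map_f esrc es) (map_f etgt es) orbT.
by rewrite big1 // => v _; rewrite ev mulr0.
Qed.

(* A face is named by its lower left corner; the edge [e] separates the faces
   [e.1] and [face_across e]. *)
Definition face_across (e : edge) : vertex :=
  if e.2 then (e.1.1 - 1, e.1.2) else (e.1.1, e.1.2 - 1).

Definition coboundary (phi : vertex -> 'F_2) (e : edge) : 'F_2 :=
  phi e.1 + phi (face_across e).

(* The value at a face counts the vertical edges of the chain to its left. *)
Lemma even_chain_coboundary (s : seq edge) (y : edge -> 'F_2) :
  uniq s -> even_chain s y ->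
  exists phi, forall e, coboundary phi e = if e \in s then y e else 0.
Proof.
move=> us ev.
pose left_of (f : vertex) (e : edge) := [&& e.2, e.1.2 == f.2 & e.1.1 <= f.1].
exists (fun f => \sum_(e <- s) y e * (left_of f e)%:R) => e0.
rewrite -sum_seq_indic // /coboundary -big_split /=.
case: e0 => -[i j] [] /=.
  apply: eq_bigr => -[[a b] []] _; rewrite -mulrDr F2_natb_add /left_of //=.
    congr (_ * (nat_of_bool _)%:R); rewrite !xpair_eqE !andbT /=.
    by case: (b == j); rewrite ?andbF ?andbT //=; lia.
  by rewrite xpair_eqE andbF.
(* The vertical edges with one end on the leftward ray from [(i, j)] are exactly those counted by
   the two faces, and the only horizontal edge leaving the ray is the given one. Adding the
   vanishing cut of the ray therefore leaves just that edge. *)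
pose ray (v : vertex) := (v.2 == j) && (v.1 <= i).
rewrite -[LHS]addr0 -[X in _ + X](even_chain_cut ray ev).
rewrite -big_split /=.
apply: eq_bigr => -[[a b] h] _; rewrite -!mulrDr !F2_natb_add.
congr (_ * (nat_of_bool _)%:R); rewrite /left_of /ray !xpair_eqE /esrc /etgt /=.
by case: h => /=; lia.
Qed.

(** Each of the four faces around a vertex borders two of its four edges, so its value enters twice
    and cancels. *)
Lemma coboundary_even (s : seq edge) (phi : vertex -> 'F_2) :
  uniq s -> (forall e, e \notin s -> coboundary phi e = 0) ->
  even_chain s (coboundary phi).
Proof.
move=> us hs [i j].
transitivity (\sum_(e <- s) coboundary phi e * (e == ((i, j), false))%:R +
  \sum_(e <- s) coboundary phi e * (e == ((i, j), true))%:R +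
  (\sum_(e <- s) coboundary phi e * (e == ((i - 1, j), false))%:R +
  \sum_(e <- s) coboundary phi e * (e == ((i, j - 1), true))%:R)).
  rewrite -!big_split /=; apply: eq_bigr => -[[a b] h] _.
  rewrite -!mulrDr /incidence !F2_natb_add.
  congr (_ * (nat_of_bool _)%:R); rewrite !xpair_eqE /esrc /etgt /=.
  by case: h; rewrite !xpair_eqE /=; lia.
rewrite !sum_seq_indic //.
have E e : (if e \in s then coboundary phi e else 0) = coboundary phi e.
  by case: ifPn => // /hs.
rewrite !E /coboundary /face_across /=.
rewrite addrACA -!addrA.
set a := phi (i, j); set b := phi _; set c := phi _; set d := phi (i - 1, j - 1).
transitivity ((a + a) + (b + b) + (c + c) + (d + d)); first by ring.
by rewrite !F2_addrr ?addr0.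
Qed.

(** A path read modulo 2 has its two endpoints as boundary; concatenating paths adds chains. *)
Lemma conn_chain (U : seq edge) (u v : vertex) : uniq U ->
  F_conn [set e | e \in U] u v ->
  exists p : edge -> 'F_2, (forall e, e \notin U -> p e = 0) /\
    forall z, \sum_(e <- U) p e * incidence z e = (z == u)%:R + (z == v)%:R.
Proof.
move=> uU; elim=> {u v} [u v [e0 [/= e0U h]]|u|u v t _ [p [p0 pb]] _ [q [q0 qb]]].
- exists (fun e => (e == e0)%:R); split => [e eU|z].
    by case: eqP => // ee; rewrite ee e0U in eU.
  under eq_bigr do rewrite mulrC.
  rewrite sum_seq_indic // e0U /incidence.
  by case: h => -[-> ->] //; rewrite addrC.
- exists (fun=> 0); split => // z.
  by rewrite F2_addrr big1 // => e _; rewrite mul0r.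
- exists (fun e => p e + q e); split => [e eU|z]; first by rewrite p0 ?q0 ?addr0.
  under eq_bigr do rewrite mulrDl.
  by rewrite big_split /= pb qb addrA -(addrA (_ == u)%:R) F2_addrr addr0.
Qed.

(** Rank-nullity: the kernel of [A] has dimension at least [#|I| - #|H|], and a spanning family
    bounds that dimension by [size V]. *)
Lemma spanned_kernel_card (I H : finType) (A : I -> H -> 'F_2)
    (V : seq {ffun I -> 'F_2}) :
  (forall x : I -> 'F_2, (forall h, \sum_i x i * A i h = 0) ->
     exists c : {ffun I -> 'F_2} -> 'F_2,
       forall i, x i = \sum_(v <- V) c v * v i) ->
  (#|I| <= #|H| + size V)%N.
Proof.
move=> span.
pose M : 'M['F_2]_(#|I|, #|H|) := \matrix_(i, h) A (enum_val i) (enum_val h).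
pose W : 'M['F_2]_(size V, #|I|) :=
  \matrix_(j, i) (tnth (in_tuple V) j) (enum_val i).
have sub : (kermx M <= W)%MS.
  apply/rV_subP => v /sub_kermxP vM.
  have [|c xc] := span (fun i => v 0 (enum_rank i)).
    move=> h; have := congr1 (fun B : 'rV_(#|H|) => B 0 (enum_rank h)) vM.
    rewrite !mxE => {2}<-; rewrite (reindex (@enum_val I (mem I))) /=; last first.
      by apply: onW_bij; exact: enum_val_bij.
    by apply: eq_bigr => i _; rewrite enum_valK mxE enum_rankK.
  apply/submxP; exists (\row_j c (tnth (in_tuple V) j)); apply/rowP => i.
  rewrite !mxE; have := xc (enum_val i); rewrite enum_valK => ->.
  by rewrite big_tnth; apply: eq_bigr => j _; rewrite !mxE.
have := mxrankS sub; rewrite mxrank_ker => h1.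
have h2 := rank_leq_col M; have h3 := rank_leq_row W.
by rewrite -leq_subLR (leq_trans _ (leq_trans h1 h3)) // leq_sub2l.
Qed.

Lemma sum_F2_another (I : finType) (x : I -> 'F_2) (P : pred I) (i : I) :
  \sum_(j | P j) x j = 0 -> P i -> x i != 0 ->
  exists j, [/\ j != i, P j & x j != 0].
Proof.
move=> s0 Pi xi.
have [/existsP[j /and3P[? ? ?]]|/existsPn no] :=
  boolP [exists j, [&& j != i, P j & x j != 0]]; first by exists j.
move: s0; rewrite (bigD1 i) //= big1 ?addr0 => [x0|j /andP[Pj ji]].
  by rewrite x0 eqxx in xi.
by have := no j; rewrite Pj ji /= negbK => /eqP.
Qed.

(* Here x is a cycle of the bipartite graph with edges [(b i, k i)]. *)
Lemma bipartite_cycle_weight (I J K : finType) (b : I -> J) (k : I -> K)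
    (x : I -> 'F_2) :
  injective (fun i => (b i, k i)) ->
  (forall j, \sum_(i | b i == j) x i = 0) ->
  (forall j, \sum_(i | k i == j) x i = 0) ->
  (exists i, x i != 0) -> (4 <= #|[pred i | (x i != 0)%R]|)%N.
Proof.
move=> inj xb xk [i xi].
(* Even degree forces a second support edge at either end of [i], and one more at the far end of
   [i1]. Simplicity of the graph keeps the four edges distinct. *)
have [i1 [n1 /eqP b1 x1]] := sum_F2_another (xb (b i)) (eqxx _) xi.
have [i2 [n2 /eqP k2 x2]] := sum_F2_another (xk (k i)) (eqxx _) xi.
have [i3 [n3 /eqP k3 x3]] := sum_F2_another (xk (k i1)) (eqxx _) x1.
have kk : k i1 != k i.
  by apply: contra n1 => /eqP E; apply/eqP/inj; rewrite b1 E.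
have bb : b i2 != b i.
  by apply: contra n2 => /eqP E; apply/eqP/inj; rewrite k2 E.
have bb3 : b i3 != b i1.
  by apply: contra n3 => /eqP E; apply/eqP/inj; rewrite k3 E.
have u : uniq [:: i; i1; i2; i3].
  rewrite /= !inE !negb_or andbT -!andbA; apply/and5P; split.
  - by rewrite eq_sym.
  - by rewrite eq_sym.
  - by apply: contra kk => /eqP ->; rewrite k3.
  - by apply: contra kk => /eqP ->; rewrite k2.
  - apply/andP; split; first by rewrite eq_sym.
    by apply: contra kk => /eqP E; rewrite -k3 -E k2.
have <- : #|[:: i; i1; i2; i3]| = 4%N by apply/card_uniqP.
apply: subset_leq_card; apply/fintype.subsetP => z.
by rewrite !inE => /or4P[] /eqP ->.
Qed.

Lemma F2_add0 (x y : 'F_2) : x + y = 0 -> x = y.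
Proof. by move=> h; rewrite -[x]addr0 -(F2_addrr y) addrA h add0r. Qed.

(** The bipartite graph is a contraction of a lattice graph: [comp] sends a vertex to its node,
    edges of [U] never change the node and link each of its vertices to its base, and each [e i]
    joins two nodes. *)
Section PlanarBipartite.
Variables (I J K : finType) (e : I -> edge) (U : seq edge).
Variables (comp : vertex -> option (J + K)) (base : J + K -> vertex).
Variables (b : I -> J) (k : I -> K).
Hypothesis uU : uniq U.
Hypothesis bk_inj : injective (fun i => (b i, k i)).
Hypothesis e_ends : forall i,
  (comp (esrc (e i)) = Some (inl (b i)) /\ comp (etgt (e i)) = Some (inr (k i)))
  \/
  (comp (etgt (e i)) = Some (inl (b i)) /\ comp (esrc (e i)) = Some (inr (k i))).
Hypothesis compU : forall e', e' \in U -> comp (esrc e') = comp (etgt e').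
Hypothesis comp_base : forall v h, comp v = Some h ->
  F_conn [set e' | e' \in U] v (base h).

Let e_inj : injective e.
Proof.
move=> i i' E; apply: bk_inj.
by case: (e_ends i) (e_ends i') => -[]; rewrite E => -> -> [] [] [] // -> [] ->.
Qed.

Let eNU i : e i \notin U.
Proof.
apply/negP => /compU.
by case: (e_ends i) => -[-> ->].
Qed.

Let s := U ++ [seq e i | i <- enum I].

Let us : uniq s.
Proof.
rewrite cat_uniq uU map_inj_uniq // enum_uniq andbT /=.
by apply/hasPn => _ /mapP[i _ ->]; exact: eNU.
Qed.

Let es i : e i \in s.
Proof. by rewrite mem_cat map_f ?orbT // mem_enum. Qed.

Let A (i : I) (h : J + K) : 'F_2 := (h == inl (b i))%:R + (h == inr (k i))%:R.

Let A_ends i h :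
  (comp (esrc (e i)) == Some h)%:R + (comp (etgt (e i)) == Some h)%:R = A i h.
Proof.
rewrite /A; case: (e_ends i) => -[-> ->]; rewrite !(inj_eq Some_inj).
  by rewrite ![_ == h]eq_sym.
by rewrite addrC ![_ == h]eq_sym.
Qed.

(** These are the functions constant on each region that [s] cuts out of the plane. *)
Let admissible phi := forall e', e' \notin s -> coboundary phi e' = 0.

Let sum_s (F : edge -> 'F_2) :
  \sum_(e' <- s) F e' = \sum_(e' <- U) F e' + \sum_i F (e i).
Proof. by rewrite big_cat big_map big_enum. Qed.

(** Cut the even chain around the vertices of the node [h]: no edge of [U] crosses, so only the
    edges [e i] count. *)
Let admissible_cycle phi h : admissible phi ->
  \sum_i coboundary phi (e i) * A i h = 0.
Proof.
move=> adm.
have := even_chain_cut (fun v => comp v == Some h) (coboundary_even us adm).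
rewrite sum_s big_seq big1 ?add0r => [E|e' /compU ->]; last first.
  by rewrite F2_addrr mulr0.
by rewrite -[RHS]E; apply: eq_bigr => i _; rewrite A_ends.
Qed.

(** The legs run inside [U] from the ends of [e i] to the bases of their nodes; together with [e i]
    they form a path between bases. *)
Let leg_chain i : exists p : edge -> 'F_2, (forall e', e' \notin U -> p e' = 0) /\
  forall z, \sum_(e' <- U) p e' * incidence z e' =
    incidence z (e i) + \sum_h (z == base h)%:R * A i h.
Proof.
have {}h : forall v h, comp v = Some h -> exists p : edge -> 'F_2,
    (forall e', e' \notin U -> p e' = 0) /\
    forall z, \sum_(e' <- U) p e' * incidence z e' =
      (z == v)%:R + \sum_h' (z == base h')%:R * (h' == h)%:R.
  move=> v h /comp_base /(conn_chain uU)[p [p0 pb]]; exists p; split => // z.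
  rewrite pb; congr (_ + _); rewrite (bigD1 h) //= eqxx mulr1 big1 ?addr0 //.
  by move=> h' /negbTE ->; rewrite mulr0.
have [p [p0 pb]] : exists p : edge -> 'F_2,
    (forall e', e' \notin U -> p e' = 0) /\
    forall z, \sum_(e' <- U) p e' * incidence z e' =
      (z == esrc (e i))%:R + (z == etgt (e i))%:R +
      \sum_h' (z == base h')%:R * A i h'.
  have aux : forall v1 v2, comp v1 = Some (inl (b i)) ->
    comp v2 = Some (inr (k i)) -> exists p : edge -> 'F_2,
    (forall e', e' \notin U -> p e' = 0) /\
    forall z, \sum_(e' <- U) p e' * incidence z e' =
      (z == v1)%:R + (z == v2)%:R + \sum_h' (z == base h')%:R * A i h'.
    move=> v1 v2 /h[p [p0 pb]] /h[q [q0 qb]].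
    exists (fun e' => p e' + q e'); split => [e' e'U|z].
      by rewrite p0 ?q0 ?addr0.
    under eq_bigr do rewrite mulrDl.
    rewrite big_split /= pb qb addrACA; congr (_ + _).
    by rewrite -big_split /=; apply: eq_bigr => h' _; rewrite -mulrDr.
  case: (e_ends i) => -[] /aux h1 /h1 // [p [p0 pb]].
  by exists p; split => // z; rewrite pb (addrC (_ == _)%:R).
by exists p; split => // z; rewrite pb.
Qed.

(** Completing each edge of the cycle by its legs gives a lattice chain whose boundary sits on the
    bases, where the cycle condition cancels it. Even chains are coboundaries. *)
Let cycle_admissible (x : I -> 'F_2) : (forall h, \sum_i x i * A i h = 0) ->
  exists2 phi, admissible phi & forall i, coboundary phi (e i) = x i.
Proof.
move=> xA; have [p pP] := choice leg_chain.
pose y e' := \sum_i x i * ((e' == e i)%:R + p i e').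
have ev : even_chain s y.
  move=> z; rewrite /y.
  transitivity (\sum_i x i * (\sum_h (z == base h)%:R * A i h)).
    under eq_bigr do rewrite big_distrl /=.
    rewrite exchange_big /=; apply: eq_bigr => i _.
    under eq_bigr do rewrite -mulrA mulrDl.
    rewrite -big_distrr big_split /=; congr (_ * _).
    under eq_bigr do rewrite mulrC.
    rewrite sum_seq_indic // es sum_s (proj2 (pP i)).
    rewrite [X in _ + (_ + X)]big1 ?addr0 => [|j _]; last first.
      by rewrite (proj1 (pP i)) ?mul0r.
    by rewrite addrA F2_addrr add0r.
  under eq_bigr do rewrite big_distrr /=.
  rewrite exchange_big big1 //= => h _.
  under eq_bigr do rewrite mulrCA.
  by rewrite -big_distrr /= xA mulr0.
have [phi phiP] := even_chain_coboundary us ev.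
exists phi => [e' /negbTE e's|i]; first by rewrite phiP e's.
rewrite phiP es /y (bigD1 i) //= eqxx (proj1 (pP i)) // addr0 mulr1.
rewrite big1 ?addr0 // => j ji.
rewrite (inj_eq e_inj) eq_sym (negbTE ji) (proj1 (pP j)) // addr0 mulr0 //.
Qed.

(* The regions of the complement, described without dual paths: faces are in the
   same region iff no admissible function separates them. *)
Let same (f g : vertex) : bool := `[< forall phi, admissible phi -> phi f = phi g >].

Let same_refl f : same f f.
Proof. by apply/asboolP. Qed.

Let same_sym f g : same f g = same g f.
Proof. by apply/asboolP/asboolP => h phi /h. Qed.

Let same_eq f g : same f g -> same^~ f =1 same^~ g.
Proof.
move=> /asboolP h t; apply/asboolP/asboolP => h' phi adm.
  by rewrite h' // h.
by rewrite h' // h.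
Qed.

(** The boundary of the region of [f], recorded on the edges [e i] only. *)
Let cls (f : vertex) : {ffun I -> 'F_2} :=
  [ffun i => coboundary (fun g => (same g f)%:R) (e i)].

Let cls_eq f g : same f g -> cls f = cls g.
Proof. by move=> /same_eq h; apply/ffunP => i; rewrite !ffunE /coboundary !h. Qed.

Let cls_admissible f : admissible (fun g => (same g f)%:R).
Proof.
move=> e' e's; rewrite /coboundary.
have h : same e'.1 (face_across e').
  by apply/asboolP => phi /(_ _ e's); exact: F2_add0.
have /= E := same_eq h f.
by rewrite (same_sym e'.1) (same_sym (face_across e')) E F2_addrr.
Qed.

Let face (j : I * bool) := if j.2 then (e j.1).1 else face_across (e j.1).

(** Repeated and zero boundaries are discarded: they add nothing to the span, and zero would violate
    the lower bound on the weight. *)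
Let V := enum [set v : {ffun I -> 'F_2} | (v != 0) && [exists j, v == cls (face j)]].

Let A_inl i j : A i (inl j) = (b i == j)%:R.
Proof. by rewrite /A -[inl _ == inr _]/false addr0 eq_sym. Qed.

Let A_inr i j : A i (inr j) = (k i == j)%:R.
Proof. by rewrite /A -[inr _ == inl _]/false add0r eq_sym. Qed.

Let V_weight v : v \in V -> (4 <= #|[pred i | (v i != 0)%R]|)%N.
Proof.
rewrite mem_enum inE => /andP[v0 /existsP[j /eqP vj]].
have cyc h := admissible_cycle h (cls_admissible (face j)).
apply: (bipartite_cycle_weight bk_inj).
- move=> j'; rewrite big_mkcond -[RHS](cyc (inl j')); apply: eq_bigr => i _.
  by rewrite vj ffunE A_inl; case: eqP; rewrite ?mulr1 ?mulr0.
- move=> j'; rewrite big_mkcond -[RHS](cyc (inr j')); apply: eq_bigr => i _.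
  by rewrite vj ffunE A_inr; case: eqP; rewrite ?mulr1 ?mulr0.
- apply/existsP; rewrite -negb_forall; apply: contra v0 => /forallP h.
  by apply/eqP/ffunP => i; rewrite ffunE; apply/eqP.
Qed.

(** Only the regions on the two sides of [e i] can have it on their boundary. *)
Let V_multiplicity i : (count (fun v : {ffun I -> 'F_2} => (v i != 0)%R) V <= 2)%N.
Proof.
rewrite -size_filter.
rewrite (@uniq_leq_size _ _ [:: cls (e i).1; cls (face_across (e i))]) //.
  by rewrite filter_uniq // enum_uniq.
move=> v; rewrite mem_filter mem_enum inE => /andP[vi /andP[_ /existsP[j /eqP vj]]].
move: vi; rewrite vj ffunE /coboundary !inE.
have [/cls_eq -> _|_] := boolP (same (e i).1 _); first by rewrite eqxx.
have [/cls_eq -> _|_] := boolP (same (face_across (e i)) _); first by rewrite eqxx orbT.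
by rewrite addr0 eqxx.
Qed.

Let V_size : (4 * size V <= 2 * #|I|)%N.
Proof.
apply: (@leq_trans (\sum_(v <- V) #|[pred i | (v i != 0)%R]|)).
  rewrite mulnC -sum1_size big_distrl /= big_seq [leqRHS]big_seq.
  by apply: leq_sum => v /V_weight.
under eq_bigr do rewrite -sum1_card.
rewrite (exchange_big_dep xpredT) //= mulnC -sum_nat_const.
apply: leq_sum => i _.
by rewrite sum1_count; exact: V_multiplicity.
Qed.

(** A canonical face per region: [pick] depends only on the extension of its predicate, so
    equivalent faces get the same representative. The default is never reached, as [j] itself
    qualifies. *)
Let rep (j : I * bool) := odflt j [pick j' | same (face j') (face j)].

Let rep_same j : same (face (rep j)) (face j).
Proof. by rewrite /rep; case: pickP => //= _; exact: same_refl. Qed.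

Let rep_eq j j' : same (face j) (face j') -> rep j = rep j'.
Proof.
move=> h; rewrite /rep.
rewrite (@eq_pick _ _ (fun t => same (face t) (face j'))); last first.
  by move=> t; exact: (same_eq h (face t)).
by case: pickP => // /(_ j); rewrite h.
Qed.

Let rep_sum phi j0 : admissible phi ->
  \sum_(j | rep j == j) phi (face j) * (same (face j0) (face j))%:R = phi (face j0).
Proof.
move=> adm; rewrite (bigD1 (rep j0)) /=; last by rewrite (rep_eq (rep_same j0)).
rewrite same_sym rep_same mulr1 big1 ?addr0 => [|j /andP[/eqP rj ne]].
  by have /asboolP := rep_same j0; apply.
have [/rep_eq E|_] := boolP (same (face j0) (face j)); last by rewrite mulr0.
by rewrite E rj eqxx in ne.
Qed.

(** The boundaries in [V] span the cycle space, which gives an Euler-type bound with [size V] in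
    place of the number of faces, and [size V] is at most half of [#|I|]. *)
Lemma planar_bipartite : (#|I| <= 2 * (#|J| + #|K|))%N.
Proof.
have : (#|I| <= #|{: J + K}| + size V)%N.
  apply: (@spanned_kernel_card I _ A) => x /cycle_admissible[phi adm xphi].
  exists (fun v => \sum_(j | rep j == j) phi (face j) * (cls (face j) == v)%:R) => i.
  under eq_bigr do rewrite big_distrl /=.
  rewrite exchange_big /=.
  transitivity (\sum_(j | rep j == j) phi (face j) * cls (face j) i).
    under eq_bigr do rewrite ffunE /coboundary mulrDr.
    rewrite big_split /= -xphi /coboundary.
    by rewrite (rep_sum (i, true)) // (rep_sum (i, false)).
  apply: eq_bigr => j _.
  under eq_bigr => v _ do rewrite -mulrA [_%:R * _]mulrC (eq_sym _ v).
  rewrite -big_distrr /=; congr (_ * _).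
  rewrite sum_seq_indic ?enum_uniq //.
  (* A boundary absent from [V] is zero, so dropping it changes nothing. *)
  case: ifPn => //; rewrite mem_enum inE negb_and negbK => /orP[/eqP ->|].
    by rewrite ffunE.
  by move=> /existsPn /(_ j); rewrite eqxx.
have := V_size.
rewrite card_sum; lia.
Qed.
End PlanarBipartite.

Local Open Scope classical_set_scope.

(** * Finite thinning of a configuration *)

Lemma eq_ler (R : numDomainType) (x y : R) : x = y -> x <= y.
Proof. by move->. Qed.

Definition subconfig (w' w : config) := forall e, w' e -> w e.

Definition close_on (S : pred edge) (w : config) : config :=
  fun e => ~~ S e && w e.

Lemma close_on_sub S w : subconfig (close_on S w) w.
Proof. by move=> e /andP[]. Qed.

Lemma subconfig_trans w1 w2 w3 :
  subconfig w1 w2 -> subconfig w2 w3 -> subconfig w1 w3.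
Proof. by move=> h12 h23 e /h12 /h23. Qed.

Lemma close_on_mono S w w' : subconfig w w' ->
  subconfig (close_on S w) (close_on S w').
Proof. by move=> h e /andP[Se /h we]; rewrite /close_on Se we. Qed.

Lemma close_onC S S' w : close_on S (close_on S' w) = close_on S' (close_on S w).
Proof. by apply/funext => e; rewrite /close_on andbCA. Qed.

Section ThinMean.
Variable R : realType.
Implicit Types (eps : R) (s : seq edge) (f g : config -> R) (w : config).

(* The expectation of f over the random configuration obtained from w by
   closing each edge of s independently with probability eps (an edge repeated
   in s gets several chances of being closed). *)
Fixpoint thin_mean eps s f w : R :=
  if s is e :: s' then
    eps * thin_mean eps s' f (close_on (pred1 e) w) +
    (1 - eps) * thin_mean eps s' f w
  else f w.

Definition increasing f := forall w w', subconfig w w' -> f w <= f w'.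

Lemma thin_mean_cst eps s c w : thin_mean eps s (fun=> c) w = c.
Proof. by elim: s w => //= e s IH w; rewrite !IH; ring. Qed.

Lemma thin_mean_sum eps s (T : Type) (r : seq T) (F : T -> config -> R) w :
  thin_mean eps s (fun w => \sum_(t <- r) F t w) w =
  \sum_(t <- r) thin_mean eps s (F t) w.
Proof.
elim: s w => //= e s IH w.
by rewrite !IH !big_distrr -big_split.
Qed.

Lemma thin_mean_close eps s f S w :
  thin_mean eps s (fun w' => f (close_on S w')) w = thin_mean eps s f (close_on S w).
Proof. by elim: s w => //= e s IH w; rewrite !IH close_onC. Qed.

Lemma thin_mean_shift eps s f (t : edge -> edge) w : injective t ->
  thin_mean eps s f (w \o t) = thin_mean eps (map t s) (fun w' => f (w' \o t)) w.
Proof.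
move=> t_inj; elim: s w => //= e s IH w; rewrite -!IH; congr (_ * thin_mean _ _ _ _ + _).
by apply/funext => e'; rewrite /close_on /= (inj_eq t_inj).
Qed.

Section Eps.
Variable eps : R.
Hypothesis eps01 : 0 <= eps <= 1.

Let eps0 : 0 <= eps. Proof. by case/andP: eps01. Qed.
Let eps1 : 0 <= 1 - eps. Proof. by rewrite subr_ge0; case/andP: eps01. Qed.

Lemma thin_mean_le s f g w : (forall w', subconfig w' w -> f w' <= g w') ->
  thin_mean eps s f w <= thin_mean eps s g w.
Proof.
elim: s w => /= [w|e s IH w] h; first exact: h.
apply: lerD; apply: ler_wpM2l => //; apply: IH => w' ww'; apply: h => //.
exact: subconfig_trans ww' (@close_on_sub _ _).
Qed.

Lemma thin_mean_ge0 s f w : (forall w', 0 <= f w') -> 0 <= thin_mean eps s f w.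
Proof. by move=> f0; rewrite -(thin_mean_cst eps s 0 w) thin_mean_le. Qed.

Lemma thin_mean_increasing s f : increasing f -> increasing (thin_mean eps s f).
Proof.
move=> incf; elim: s => //= e s IH w w' ww'.
by apply: lerD; apply: ler_wpM2l => //; apply: IH => //; exact: close_on_mono.
Qed.

(** Induction on the thinned edges: for a single edge the gap is the covariance
    [eps * (1 - eps) * ((A - a) * (B - b))], nonnegative for increasing functions. *)
Lemma thin_mean_harris s f g w : increasing f -> increasing g ->
  thin_mean eps s f w * thin_mean eps s g w <=
  thin_mean eps s (fun w' => f w' * g w') w.
Proof.
move=> incf incg; elim: s w => //= e s IH w.
have := IH w; have := IH (close_on (pred1 e) w).
have := thin_mean_increasing s incf (@close_on_sub (pred1 e) w).
have := thin_mean_increasing s incg (@close_on_sub (pred1 e) w).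
set a := thin_mean _ _ f _; set A := thin_mean _ _ f w.
set b := thin_mean _ _ g _; set B := thin_mean _ _ g w.
set c := thin_mean _ _ _ _; set C := thin_mean _ _ _ w.
move=> bB aA abc ABC.
have h1 := ler_wpM2l eps0 abc; have h2 := ler_wpM2l eps1 ABC.
apply: le_trans (lerD h1 h2).
rewrite -subr_ge0.
have -> : eps * (a * b) + (1 - eps) * (A * B) -
  (eps * a + (1 - eps) * A) * (eps * b + (1 - eps) * B) =
  eps * (1 - eps) * ((A - a) * (B - b)) by ring.
by rewrite !mulr_ge0 // subr_ge0.
Qed.

(** Keep only the outcomes closing every edge of [S] listed in [s]; each listed occurrence costs a
    factor [eps]. *)
Lemma thin_mean_close_ge s f (S : pred edge) w : (forall w', 0 <= f w') ->
  eps ^+ count S s * thin_mean eps s f (close_on (fun e => S e && (e \in s)) w)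
  <= thin_mean eps s f w.
Proof.
move=> f0; elim: s w => /= [|e s IH] w.
  rewrite mul1r; apply: eq_ler; congr (f _).
  by apply/funext => e; rewrite /close_on in_nil andbF.
set w1 := close_on (fun _ => _) w.
have [Se|Se] /= := boolP (S e).
- have -> : close_on (pred1 e) w1 = w1.
    apply/funext => e'; rewrite /w1 /close_on /= in_cons.
    by case: eqP => [->|//]; rewrite Se.
  rewrite -mulrDl addrC subrK mul1r exprS -mulrA.
  rewrite -[leLHS]addr0; apply: lerD; last first.
    by rewrite mulr_ge0 ?thin_mean_ge0.
  apply: ler_wpM2l => //; apply: le_trans (IH _).
  apply: ler_wpM2l; first exact: exprn_ge0.
  apply: eq_ler; congr thin_mean; apply/funext => e'.
  rewrite /w1 /close_on /= in_cons.
  by case: eqP => [->|_] /=; rewrite ?Se // andbF.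
- have E : w1 = close_on (fun e0 => S e0 && (e0 \in s)) w.
    apply/funext => e'; rewrite /w1 /close_on /= in_cons.
    by case: eqP => [->|_] //=; rewrite (negbTE Se).
  rewrite add0n mulrDr; apply: lerD; rewrite mulrCA; apply: ler_wpM2l => //.
    by rewrite E close_onC.
  by rewrite E.
Qed.

Lemma thin_mean_antitone_eps eps' s f w : 0 <= eps' <= eps -> increasing f ->
  thin_mean eps s f w <= thin_mean eps' s f w.
Proof.
move=> /andP[e0 ee] incf; elim: s w => //= e s IH w.
have h1 := IH w; have h2 := IH (close_on (pred1 e) w).
have h3 := thin_mean_increasing s incf (@close_on_sub (pred1 e) w).
have e1 : 0 <= 1 - eps' by apply: le_trans eps1 _; rewrite lerB.
apply: le_trans (lerD (ler_wpM2l e0 h2) (ler_wpM2l e1 h1)).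
rewrite -subr_ge0.
set a := thin_mean _ _ _ _; set A := thin_mean _ _ _ w.
have -> : eps' * a + (1 - eps') * A - (eps * a + (1 - eps) * A) =
  (eps - eps') * (A - a) by ring.
by rewrite mulr_ge0 ?subr_ge0.
Qed.

End Eps.

Definition ind (A : config -> Prop) (w : config) : R := (`[< A w >])%:R.

Lemma ind_ge0 A w : 0 <= ind A w.
Proof. exact: ler0n. Qed.

Lemma ind_le (A A' : config -> Prop) w w' : (A w -> A' w') -> ind A w <= ind A' w'.
Proof.
move=> h; rewrite /ind; case: asboolP => [/h a|_]; last exact: ler0n.
by case: asboolP.
Qed.

Lemma ind_and A A' w : ind (fun w => A w /\ A' w) w = ind A w * ind A' w.
Proof.
rewrite /ind -natrM mulnb; congr (nat_of_bool _)%:R.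
by apply/asboolP/andP => -[/asboolP ? /asboolP ?].
Qed.

Section Thinning.
Variables (d : measure_display) (Om : measurableType d) (Q : probability Om R).
Variables (xi : Om -> edge -> bool) (eps : R).
Hypothesis xiP : iid_bernoulli Q xi eps.
Hypothesis eps01 : 0 <= eps <= 1.

Let atom (t : seq edge) (b : edge -> bool) :=
  [set o | forall e, e \in t -> xi o e = b e].

Let measurable_atom t b : measurable (atom t b).
Proof.
elim: t => [|e t IH].
  by rewrite (_ : atom _ _ = setT) //; apply/seteqP; split.
have -> : atom (e :: t) b = [set o | xi o e = b e] `&` atom t b.
  apply/seteqP; split => o.
    move=> h; split; first by apply: h; rewrite mem_head.
    by move=> e' e't; apply: h; rewrite in_cons e't orbT.
  by move=> [h1 h2] e'; rewrite in_cons => /orP[/eqP ->|/h2].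
apply: measurableI => //; have [m _] := xiP.
case: (b e); first exact: m.
rewrite (_ : mkset _ = ~` [set o | xi o e]); first exact: measurableC.
by apply/seteqP; split => o /=; case: (xi o e).
Qed.

Let prob_split (t : seq edge) b e (B : set Om) : e \notin t -> measurable B ->
  (Q (B `&` atom t b) <=
    Q (B `&` atom (e :: t) (fun e' => if e' == e then true else b e')) +
    Q (B `&` atom (e :: t) (fun e' => if e' == e then false else b e')))%E.
Proof.
move=> et mB; apply: le_trans (measureU2 _ _ _); try exact: measurableI.
apply: le_measure; rewrite ?inE; try exact: measurableI.
  by apply: measurableU; exact: measurableI.
move=> o [Bo ao]; case E : (xi o e); [left|right]; split => // e'.
- rewrite in_cons; case: eqP => [->|_ /ao] //=.
- rewrite in_cons; case: eqP => [->|_ /ao] //=.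
Qed.

(** Here [t] lists the edges already exposed, with outcomes [b], and [s] those still to come. At the
    end, [xi] closes at least the edges exposed as closed, so the increasing event [A] also holds
    when these alone are closed. *)
Lemma thin_mean_prob_gen (A : config -> Prop) (B : set Om) w t b s :
  measurable B -> increasing (ind A) ->
  (forall o, B o -> A (close_on (xi o) w)) -> uniq (t ++ s) ->
  (Q (B `&` atom t b) <=
   (\prod_(e <- t) (if b e then eps else 1 - eps) *
    thin_mean eps s (ind A) (close_on (fun e => (e \in t) && b e) w))%:E)%E.
Proof.
move=> mB incA BA; have [_ pr] := xiP.
elim: s t b => /= [|e s IH] t b.
  rewrite cats0 => ut.
  have [[o [Bo ao]]|no] := pselect (exists o, B o /\ atom t b o); last first.
    rewrite (_ : _ `&` _ = set0) ?measure0; last first.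
      by apply/seteqP; split => o // [? ?]; apply: no; exists o.
    rewrite lee_fin mulr_ge0 ?ind_ge0 // prodr_ge0 // => e _.
    by case: ifP => _; move: eps01 => /andP[]; lra.
  have -> : ind A (close_on (fun e => (e \in t) && b e) w) = 1.
    apply/eqP; rewrite eq_le; apply/andP; split.
      by rewrite /ind; case: asboolP; rewrite ?ler01.
    have <- : ind A (close_on (xi o) w) = 1.
      by rewrite /ind (asboolT (BA _ Bo)).
    apply: incA => e /andP[ne we]; rewrite /close_on we andbT.
    by case: (boolP (e \in t)) => //= et; rewrite -(ao e et).
  rewrite mulr1 -pr //; apply: le_measure; rewrite ?inE //.
    exact: measurableI.
  exact: measurable_atom.
rewrite uniq_catC /= => /andP[]; rewrite mem_cat negb_or => /andP[es et] uts.
have uets : uniq ((e :: t) ++ s) by rewrite /= mem_cat negb_or et es uniq_catC.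
apply: le_trans (prob_split b et mB) _.
apply: le_trans (leeD (IH _ _ uets) (IH _ _ uets)) _.
rewrite !big_cons eqxx -EFinD lee_fin.
have pE c : \prod_(j <- t) (if if j == e then c else b j then eps else 1 - eps) =
    \prod_(j <- t) (if b j then eps else 1 - eps).
  apply: eq_big_seq => j jt; case: eqP => // je.
  by rewrite -je jt in et.
rewrite !pE.
set p := \prod_(_ <- _) _.
have -> : close_on (fun e0 => (e0 \in e :: t) && (if e0 == e then true else b e0)) w
  = close_on (pred1 e) (close_on (fun e => (e \in t) && b e) w).
  apply/funext => e'; rewrite /close_on /= in_cons.
  by case: eqP => //= ->; rewrite (negbTE et).
have -> : close_on (fun e0 => (e0 \in e :: t) && (if e0 == e then false else b e0)) w
  = close_on (fun e => (e \in t) && b e) w.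
  apply/funext => e'; rewrite /close_on /= in_cons.
  by case: eqP => //= ->; rewrite (negbTE et).
by apply: eq_ler; ring.
Qed.

Lemma thin_mean_prob (A : config -> Prop) (B : set Om) w s :
  measurable B -> increasing (ind A) ->
  (forall o, B o -> A (close_on (xi o) w)) -> uniq s ->
  (Q B <= (thin_mean eps s (ind A) w)%:E)%E.
Proof.
move=> mB incA BA us.
have := @thin_mean_prob_gen A B w [::] (fun=> false) s mB incA BA us.
rewrite big_nil mul1r (_ : close_on _ w = w); last exact/funext.
by rewrite (_ : atom _ _ = setT) ?setIT //; apply/seteqP; split.
Qed.

End Thinning.
End ThinMean.
Arguments ind {R} A w.

(** * Robust clusters survive thinning *)

Definition dist1 (u v : vertex) : int := `|v.1 - u.1| + `|v.2 - u.2|.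

(** Balls are finite, so the cluster of [v] is infinite exactly when this holds for every [N]. *)
Definition reach (N : nat) (v : vertex) (w : config) : Prop :=
  exists y, N%:Z < dist1 v y /\ F_conn (open_edges w) v y.

Lemma F_conn_mono (F F' : set edge) x y : F `<=` F' -> F_conn F x y -> F_conn F' x y.
Proof.
move=> FF; elim=> [u v [e [Fe h]]|u|u v t _ IH _ IH'].
- by apply: rt_step; exists e; split => //; exact: FF.
- exact: rt_refl.
- exact: rt_trans IH IH'.
Qed.

Lemma F_adj_sym (F : set edge) x y : F_adj F x y -> F_adj F y x.
Proof. by move=> [e [Fe h]]; exists e; split => //; case: h; [right|left]. Qed.

Lemma F_conn_sym (F : set edge) x y : F_conn F x y -> F_conn F y x.
Proof.
elim=> [u v /F_adj_sym|u|u v t _ IH _ IH']; first exact: rt_step.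
- exact: rt_refl.
- exact: rt_trans IH' IH.
Qed.

Lemma open_edges_mono w w' : subconfig w w' -> open_edges w `<=` open_edges w'.
Proof. by move=> h e; exact: h. Qed.

Lemma reach_mono N v w w' : subconfig w w' -> reach N v w -> reach N v w'.
Proof.
move=> h [y [fy c]]; exists y; split => //.
exact: F_conn_mono (open_edges_mono h) c.
Qed.

Lemma ind_reach_increasing (R : realType) N v : increasing (@ind R (reach N v)).
Proof. by move=> w w' h; apply: ind_le; exact: reach_mono. Qed.

Lemma dist1_ball_finite (v : vertex) (N : nat) :
  finite_set [set y | dist1 v y <= N%:Z].
Proof.
pose l := [seq ((v.1 + i%:Z - N%:Z, v.2 + j%:Z - N%:Z) : vertex) |
            i <- iota 0 (2 * N).+1, j <- iota 0 (2 * N).+1].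
apply: (@sub_finite_set _ _ [set` l]); last exact: finite_seq.
move=> [a b]; rewrite /dist1 /= => h; apply/allpairsP.
exists (absz (a - v.1 + N%:Z), absz (b - v.2 + N%:Z)); rewrite !mem_iota /=.
split; [lia|lia|congr pair; lia].
Qed.

(** * Measurability of connection events and thinned means *)

Section Measurability.
Variables (R : realType) (d : measure_display) (Om : measurableType d).

Lemma measurable_exists (T : countType) (A : T -> set Om) :
  (forall t, measurable (A t)) -> measurable [set o | exists t, A t o].
Proof.
move=> mA; rewrite (_ : mkset _ = \bigcup_t A t).
  by apply: countable_bigcupT_measurable => //; exact: countableP.
by apply/seteqP; split => o [t]; [exists t|exists t].
Qed.

Lemma measurable_forall (T : countType) (A : T -> set Om) :
  (forall t, measurable (A t)) -> measurable [set o | forall t, A t o].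
Proof.
move=> mA; rewrite (_ : mkset _ = ~` [set o | exists t, ~ A t o]).
  by apply: measurableC; apply: measurable_exists => t; exact: measurableC.
apply/seteqP; split => o /= h; first by move=> [t]; apply.
by move=> t; apply: contrapT => nA; apply: h; exists t.
Qed.

Lemma measurable_prop (P : Prop) : measurable [set _ : Om | P].
Proof.
have [p|np] := pselect P.
  by rewrite (_ : mkset _ = setT) //; apply/seteqP; split.
by rewrite (_ : mkset _ = set0) //; apply/seteqP; split.
Qed.

Lemma positive_measure_cover (Q : probability Om R) (T : countType)
    (A : T -> set Om) (B : set Om) :
  (forall t, measurable (A t)) -> measurable B ->
  B `<=` \bigcup_t A t -> (0 < Q B)%E -> exists t, (0 < Q (A t))%E.
Proof.
move=> mA mB BA QB; apply: contrapT => no.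
suff : Q.-negligible B by move/negligibleP => /(_ mB) QB0; rewrite QB0 ltxx in QB.
pose F n := if @unpickle T n is Some t then A t else set0.
apply: (@negligibleS _ _ _ _ (\bigcup_n F n)).
  by move=> o /BA[t _ Ato]; exists (pickle t) => //; rewrite /F pickleK.
apply: negligible_bigcup => n; rewrite /F; case: unpickle => [t|]; last first.
  exact: negligible_set0.
apply/negligibleP => //; apply/eqP; rewrite eq_le measure_ge0 andbT leNgt.
by apply/negP => h; apply: no; exists t.
Qed.

Definition config_rv (Y : Om -> config) := forall e, measurable [set o | Y o e].

Lemma config_rv_close S Y : config_rv Y -> config_rv (fun o => close_on S (Y o)).
Proof.
move=> mY e; rewrite /close_on; case: (S e) => /=; last exact: mY.
by rewrite (_ : mkset _ = set0) //; apply/seteqP; split.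
Qed.

(** Walks are indexed by a countable type, which turns connectivity into a countable union. *)
Fixpoint walk (F : set edge) (x : vertex) (p : seq vertex) (y : vertex) : Prop :=
  if p is z :: p' then F_adj F x z /\ walk F z p' y else x = y.

Lemma F_conn_walk F x y : F_conn F x y <-> exists p, walk F x p y.
Proof.
split=> [c|[p]].
  elim: (clos_rt_rt1n _ _ _ _ c) => {x y c} [x|x z y xz _ [p h]]; first by exists [::].
  by exists (z :: p).
elim: p x => /= [x ->|z p IH x [xz /IH]]; first exact: rt_refl.
by apply: rt_trans; exact: rt_step.
Qed.

Lemma measurable_conn Y x y : config_rv Y ->
  measurable [set o | F_conn (open_edges (Y o)) x y].
Proof.
move=> mY; rewrite (_ : mkset _ = [set o | exists p, walk (open_edges (Y o)) x p y]).
  apply: (@measurable_exists (seq vertex) (fun p => [set o | walk _ x p y])) => p.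
  elim: p x => /= [x|z p IH x]; first exact: measurable_prop.
  apply: measurableI; last exact: IH.
  apply: (@measurable_exists edge (fun e => [set o | Y o e /\ _])) => e.
  by apply: measurableI; [exact: mY|exact: measurable_prop].
by apply/seteqP; split => o /F_conn_walk.
Qed.

Lemma measurable_reach Y N v : config_rv Y -> measurable [set o | reach N v (Y o)].
Proof.
move=> mY; apply: (@measurable_exists vertex (fun y => [set o | _ /\ _])) => y.
by apply: measurableI; [exact: measurable_prop|exact: measurable_conn].
Qed.

Lemma measurable_thin_mean (eps : R) s (A : config -> Prop) Y :
  (forall Y, config_rv Y -> measurable [set o | A (Y o)]) -> config_rv Y ->
  measurable_fun setT (fun o => thin_mean eps s (ind A) (Y o)).
Proof.
move=> mA; elim: s Y => /= [|e s IH] Y mY.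
  rewrite (_ : (fun _ => _) = \1_[set o | A (Y o)]).
    by apply: measurable_indic; exact: mA.
  by apply/funext => o; rewrite indicE /ind /in_mem /= /in_set.
apply: measurable_funD; apply: measurable_funM; try exact: measurable_cst.
  by apply: IH; exact: config_rv_close.
exact: IH.
Qed.
End Measurability.

(* The bound is uniform over all finite sets s of thinned edges; quantifying over
   s rather than fixing an exhaustion makes the event translation covariant. *)
Definition survives (R : realType) (k : nat) (v : vertex) (w : config) : Prop :=
  forall (s : seq edge) (N : nat), uniq s ->
    (k.+1%:R^-1 : R) <= thin_mean k.+1%:R^-1 s (ind (reach N v)) w.

Lemma invS_gt0_le1 (R : realType) k : 0 <= (k.+1%:R^-1 : R) <= 1.
Proof. by rewrite invr_ge0 ler0n /= invf_le1 ?ler1n ?ltr0n. Qed.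

(** Raising [k] helps twice: fewer edges are closed and the required bound drops. *)
Lemma survives_mono (R : realType) k k' v w : (k <= k')%N ->
  survives R k v w -> survives R k' v w.
Proof.
move=> kk h s N us.
have lek : (k'.+1%:R^-1 : R) <= k.+1%:R^-1 by rewrite lef_pV2 ?posrE ?ltr0n ?ler_nat.
apply: (le_trans lek); apply: le_trans (h s N us) _.
apply: thin_mean_antitone_eps; first exact: invS_gt0_le1.
  by rewrite lek andbT; case/andP: (invS_gt0_le1 R k').
exact: ind_reach_increasing.
Qed.

Lemma exists_invS_le (R : realType) (x : R) : 0 < x -> exists k, k.+1%:R^-1 <= x.
Proof.
move=> x0; exists (Num.truncn x^-1).
rewrite invf_ple ?posrE ?ltr0n //; apply: ltW.
by rewrite truncnS_gt.
Qed.

(** By countability, some fixed vertex [v] lies in an infinite component with positive probability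
    [q]. Thinning only finitely many edges closes less, so the same [q] bounds every finite thinned
    mean from below. *)
Lemma robust_survives (R : realType) w x : robust_cluster R w (cluster w x) ->
  exists v, F_conn (open_edges w) x v /\ exists k, survives R k v w.
Proof.
move=> [eps [/andP[eps0 eps1] [d [Om [Q [xi [xiP [B [mB [Binf QB]]]]]]]]]].
pose w0 : config := fun e => `[< cluster_edges w (cluster w x) e >].
pose Y o := close_on (xi o) w0.
have mY : config_rv Y.
  move=> e; rewrite /Y /close_on.
  rewrite (_ : mkset _ = ~` [set o | xi o e] `&` [set o | w0 e]).
    apply: measurableI; last exact: measurable_prop.
    by apply: measurableC; case: xiP.
  by apply/seteqP; split => o /=; [move=> /andP[/negP]|move=> [/negP -> ->]].
pose A v := B `&` [set o | forall N, reach N v (Y o)].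
have mA v : measurable (A v).
  apply: measurableI => //.
  apply: (@measurable_forall _ _ nat (fun N => [set o | reach N v (Y o)])) => N.
  exact: measurable_reach.
have [v QA] : exists v, (0 < Q (A v))%E.
  apply: (positive_measure_cover mA mB _ QB) => o Bo.
  have [v vinf] := Binf o Bo; exists v => //; split => // N.
  apply: contrapT => nr; apply: vinf.
  apply: sub_finite_set (dist1_ball_finite v N) => y /= yc.
  rewrite leNgt; apply/negP => fy; apply: nr; exists y; split => //.
  apply: F_conn_mono yc => e [we xe].
  by rewrite /open_edges /= /Y /close_on xe; exact/asboolP.
have subY o : subconfig (Y o) (close_on (xi o) w).
  by move=> e /andP[h /asboolP[we _]]; rewrite /close_on h we.
exists v; split.
  (* Leaving [v] at all requires an open edge at [v], and such an edge belongs to the cluster of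
     [x]. *)
  have [o [_ /(_ 0%N)[y [vy c]]]] : A v !=set0.
    by apply/set0P/negP => /eqP A0; rewrite A0 measure0 ltxx in QA.
  case: (clos_rt_rt1n _ _ _ _ c) vy => [|z t [e [Ye h]] _ _].
    by rewrite /dist1; lia.
  move: Ye; rewrite /open_edges /= => /andP[_ /asboolP[we ce]].
  case: h => -[hs ht]; first by rewrite -hs.
  rewrite /cluster /= hs in ce; apply: rt_trans ce _; apply: rt_step.
  by exists e; split => //; left.
have [q q0 qA] : exists2 q : R, 0 < q & (q%:E <= Q (A v))%E.
  have Qfin : Q (A v) \is a fin_num by exact: fin_num_measure.
  exists (fine (Q (A v))); last by rewrite fineK.
  by rewrite fine_gt0 // QA /= ltey_eq Qfin.
(* A single [k] must serve both as thinning parameter, hence below [eps], and as lower bound, hence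
   below [q]. *)
have [k] : exists k, k.+1%:R^-1 <= Num.min q eps.
  by apply: exists_invS_le; rewrite lt_min q0 eps0.
rewrite le_min => /andP[kq keps].
exists k => s N us; apply: le_trans kq _.
have eps01 : 0 <= eps <= 1 by rewrite (ltW eps0).
apply: le_trans (_ : thin_mean eps s (ind (reach N v)) w <= _); last first.
  apply: thin_mean_antitone_eps => //; last exact: ind_reach_increasing.
  by rewrite keps andbT; case/andP: (invS_gt0_le1 R k).
rewrite -lee_fin; apply: le_trans qA _.
apply: (thin_mean_prob xiP) => //; first exact: ind_reach_increasing.
by move=> o [_ /(_ N)]; exact: reach_mono.
Qed.

(** The parameters [k] and [v] range over a countable set, so some fixed choice has positive
    probability. *)
Definition encounter (R : realType) (k : nat) (v : 'I_3 -> vertex)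
    (w : config) : Prop :=
  (forall i j, i != j -> ~ F_conn (open_edges w) (v i) (v j)) /\
  forall i, survives R k (v i) w.

Lemma measurable_encounter (R : realType) k v (d : measure_display)
    (Om : measurableType d) (Y : Om -> config) : config_rv Y ->
  measurable [set o | encounter R k v (Y o)].
Proof.
move=> mY; apply: measurableI.
  apply: (@measurable_forall _ _ 'I_3 (fun i => [set o | forall j, _])) => i.
  apply: (@measurable_forall _ _ 'I_3 (fun j => [set o | _ -> _])) => j.
  case: (i != j); last by rewrite (_ : mkset _ = setT) //; apply/seteqP; split.
  rewrite (_ : mkset _ = ~` [set o | F_conn (open_edges (Y o)) (v i) (v j)]).
    by apply: measurableC; exact: measurable_conn.
  by apply/seteqP; split => o /=; [exact|move=> + _].
apply: (@measurable_forall _ _ 'I_3 (fun i => [set o | survives R k (v i) (Y o)])) => i.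
apply: (@measurable_forall _ _ (seq edge) (fun s => [set o | forall N, uniq s -> _])) => s.
apply: (@measurable_forall _ _ nat (fun N => [set o | uniq s -> _])) => N.
case: (uniq s); last by rewrite (_ : mkset _ = setT) //; apply/seteqP; split.
have := @measurable_thin_mean R _ Om k.+1%:R^-1 s (reach N (v i)) Y
  (fun Y h => measurable_reach N (v i) h) mY.
move=> mf.
have mc : measurable_fun [set: Om] (fun=> k.+1%:R^-1 : R) by exact: measurable_cst.
have := measurable_fun_ler mc mf measurableT (Y := [set true]).
rewrite setTI => mle.
rewrite (_ : mkset _ = (fun o => (k.+1%:R^-1 : R) <=
    thin_mean k.+1%:R^-1 s (ind (reach N (v i))) (Y o)) @^-1` [set true]).
  exact: mle.
by apply/seteqP; split => o /=; [apply|move=> + _].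
Qed.

(** Apply the previous lemma to the identity on the space of configurations. *)
Lemma config_measurable_encounter (R : realType) k v :
  config_measurable (encounter R k v).
Proof.
apply: (@measurable_encounter R k v _ (g_sigma_algebraType coord_events) id) => e.
by apply: sub_sigma_algebra; exists e.
Qed.

Lemma more_than_two_robust_encounter (R : realType) w : more_than_two_robust R w ->
  exists k v, encounter R k v w.
Proof.
move=> [x [y [z [xy [xz [yz [rx [ry rz]]]]]]]].
have [x' [xx [kx sx]]] := robust_survives rx.
have [y' [yy [ky sy]]] := robust_survives ry.
have [z' [zz [kz sz]]] := robust_survives rz.
exists (maxn kx (maxn ky kz)).
exists (fun i : 'I_3 =>
  if i == 0 :> nat then x' else if i == 1%N :> nat then y' else z').
have key (a a' b b' : vertex) : F_conn (open_edges w) a a' ->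
    F_conn (open_edges w) b b' -> ~ F_conn (open_edges w) a b ->
    ~ F_conn (open_edges w) a' b'.
  move=> ha hb no h; apply: no.
  exact: rt_trans ha (rt_trans _ _ _ _ _ h (F_conn_sym hb)).
have sym (a b : vertex) : ~ F_conn (open_edges w) a b -> ~ F_conn (open_edges w) b a.
  by move=> no /F_conn_sym.
split.
  move=> [[|[|[|]]] //= i3] [[|[|[|]]] //= j3] // _.
  - exact: key xy.
  - exact: key xz.
  - exact: sym (key _ _ _ _ xx yy xy).
  - exact: key yz.
  - exact: sym (key _ _ _ _ xx zz xz).
  - exact: sym (key _ _ _ _ yy zz yz).
move=> [[|[|[|]]] //= i3].
- by apply: survives_mono sx; rewrite leq_max leqnn.
- by apply: survives_mono sy; rewrite !leq_max leqnn orbT.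
- by apply: survives_mono sz; rewrite !leq_max leqnn !orbT.
Qed.

(** * Good boxes *)

Definition inbox (m : nat) (a v : vertex) : bool :=
  (a.1 <= v.1 <= a.1 + m%:Z) && (a.2 <= v.2 <= a.2 + m%:Z).

Definition touches (m : nat) (a : vertex) (e : edge) : bool :=
  inbox m a (esrc e) || inbox m a (etgt e).

Definition box_seq (m : nat) (a : vertex) : seq vertex :=
  [seq (a.1 + i%:Z, a.2 + j%:Z) | i <- iota 0 m.+1, j <- iota 0 m.+1].

Lemma mem_box_seq m a v : (v \in box_seq m a) = inbox m a v.
Proof.
case: a v => a b [x y]; rewrite /inbox /=; apply/allpairsP/idP => [[[i j]]|h].
  by rewrite !mem_iota /= => -[? ? [-> ->]]; lia.
exists (absz (x - a), absz (y - b)); rewrite !mem_iota /=.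
split; [lia|lia|congr pair; lia].
Qed.

Definition box_edges (m : nat) (a : vertex) : seq edge :=
  [seq (v, h) | v <- box_seq m a, h <- [:: false; true]].

Lemma mem_box_edges m a e : (e \in box_edges m a) = inbox m a (esrc e).
Proof.
rewrite -mem_box_seq; apply/allpairsP/idP => [[[v h] [vb _ ->]]//|vb].
by exists (e.1, e.2); rewrite /= -surjective_pairing; split => //; case: (e.2).
Qed.

Lemma size_box_edges m a : size (box_edges m a) = (2 * (m.+1) ^ 2)%N.
Proof. by rewrite !size_allpairs !size_iota /=; lia. Qed.

Lemma touches_box_edges m (a : vertex) e :
  touches m a e -> e \in box_edges m.+1 (a.1 - 1, a.2 - 1).
Proof.
rewrite mem_box_edges /touches /inbox /etgt /esrc.
by case: e => -[x y] [] /=; lia.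
Qed.

(* The edges [f i] make the box at a vertex of degree three in the bipartite graph
   of boxes and clusters. *)
Definition good (m L : nat) (a : vertex) (w : config) : Prop :=
  (forall e, touches m a e -> ~~ w e) /\
  exists c : 'I_3 -> vertex, exists f : 'I_3 -> edge,
    (forall i,
      [/\ (inbox m a (esrc (f i)) /\ etgt (f i) = c i) \/
          (inbox m a (etgt (f i)) /\ esrc (f i) = c i),
          ~~ inbox m a (c i) &
          exists y, L%:Z < dist1 a y /\ F_conn (open_edges w) (c i) y]) /\
    (forall i j, i != j -> ~ F_conn (open_edges w) (c i) (c j)).

Lemma box_connected (F : set edge) m a v :
  (forall e, inbox m a (esrc e) -> inbox m a (etgt e) -> F e) ->
  inbox m a v -> F_conn F v a.
Proof.
move=> hF; suff h i j : (i <= m)%N -> (j <= m)%N -> F_conn F (a.1 + i%:Z, a.2 + j%:Z) a.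
  rewrite /inbox => vb.
  have := h (absz (v.1 - a.1)) (absz (v.2 - a.2)).
  have -> : a.1 + (absz (v.1 - a.1))%:Z = v.1 by lia.
  have -> : a.2 + (absz (v.2 - a.2))%:Z = v.2 by lia.
  by rewrite -surjective_pairing; apply; lia.
elim: i => [|i IH] im jm.
  elim: j jm => [|j IH] jm.
    by rewrite !addr0 -surjective_pairing; exact: rt_refl.
  apply: rt_trans (IH _); last by lia.
  apply: rt_step; exists ((a.1 + 0%:Z, a.2 + j%:Z), true); split.
    by apply: hF; rewrite /inbox /esrc /etgt /=; lia.
  by right; split => //; rewrite /etgt /=; congr pair; lia.
apply: rt_trans (IH _ _) => //; last by lia.
apply: rt_step; exists ((a.1 + i%:Z, a.2 + j%:Z), false); split.
  by apply: hF; rewrite /inbox /esrc /etgt /=; lia.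
by right; split => //; rewrite /etgt /=; congr pair; lia.
Qed.

(** After its last visit to [P] the path uses only edges not touching [P], so this tail survives the
    closing of a box. *)
Lemma last_exit (F : set edge) (P : vertex -> bool) x y :
  F_conn F x y -> ~~ P y ->
  let F' := [set e | F e /\ ~~ (P (esrc e) || P (etgt e))] in
  (~~ P x /\ F_conn F' x y) \/
  exists u c, [/\ P u, ~~ P c, F_adj F u c, F_conn F x u & F_conn F' c y].
Proof.
move=> c; elim: (clos_rt_rt1n _ _ _ _ c) => {x y c} [x Px /=|x z y xz _ IH Py /=].
  by left; split => //; exact: rt_refl.
case: (IH Py) => /= [[Pz zy]|[u [c [Pu Pc uc zu cy]]]].
  have [Px|Px] := boolP (P x).
    by right; exists x, z; split => //; exact: rt_refl.
  left; split => //; apply: rt_trans zy; apply: rt_step.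
  have [e [Fe h]] := xz; exists e; split => //; split => //.
  by case: h => -[-> ->]; rewrite negb_or Px Pz.
right; exists u, c; split => //; apply: rt_trans zu; exact: rt_step.
Qed.

(** Each [c i] is where an arm leaves the box for the last time; it is joined to [v i] in [w], so
    the three remain disconnected. The box has l1-diameter [2 * m], so the slack [4 * m] puts the
    far end outside the box and farther than [L] from [a]. *)
Lemma reach_good m L a (v : 'I_3 -> vertex) w w' : subconfig w' w ->
  (forall i, inbox m a (v i)) ->
  (forall i j, i != j -> ~ F_conn (open_edges w) (v i) (v j)) ->
  (forall i, reach (L + 4 * m) (v i) w') ->
  good m L a (close_on (touches m a) w').
Proof.
move=> sub vb vnc vr; split => [e te|]; first by rewrite /close_on te.
have ex i : exists cf : vertex * edge,
    [/\ (inbox m a (esrc cf.2) /\ etgt cf.2 = cf.1) \/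
          (inbox m a (etgt cf.2) /\ esrc cf.2 = cf.1),
        ~~ inbox m a cf.1,
        F_conn (open_edges w) (v i) cf.1 &
        exists y, L%:Z < dist1 a y /\
          F_conn (open_edges (close_on (touches m a) w')) cf.1 y].
  have [y [far vy]] := vr i.
  have yb : ~~ inbox m a y.
    by move: far (vb i); rewrite /dist1 /inbox; lia.
  have [[]|/=] := last_exit vy yb; first by rewrite vb.
  move=> [u [c [ub cb [f [wf uc]] vu cy]]].
  exists (c, f); split => //=.
  - by case: uc => -[<- <-] in ub *; [left|right].
  - apply: rt_trans (F_conn_mono (open_edges_mono sub) vu) _.
    by apply: rt_step; exists f; split => //; exact: sub.
  - exists y; split; first by move: far (vb i); rewrite /dist1 /inbox; lia.
    apply: F_conn_mono cy => e [we te].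
    by rewrite /open_edges /= /close_on /touches te.
have [cf cfP] := choice ex.
exists (fun i => (cf i).1), (fun i => (cf i).2); split => [i|i j ij cij].
  by have [] := cfP i.
have [_ _ vi _] := cfP i; have [_ _ vj _] := cfP j.
apply: (vnc i j ij); apply: rt_trans vi _; apply: rt_trans (F_conn_sym vj).
apply: F_conn_mono cij; apply: open_edges_mono.
exact: subconfig_trans (@close_on_sub _ _) sub.
Qed.

(** Closing the edges touching the box costs at most [2 * m.+2 ^ 2] factors, as they all start in a
    box of side [m.+1]. By Harris' inequality the three reach events hold jointly at the cost of
    three more factors. *)
Lemma encounter_good (R : realType) k m L a (v : 'I_3 -> vertex) w s :
  encounter R k v w -> (forall i, inbox m a (v i)) ->
  uniq s -> (forall e, touches m a e -> e \in s) ->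
  (k.+1%:R^-1 : R) ^+ (2 * m.+2 ^ 2 + 3) <=
  thin_mean k.+1%:R^-1 s (ind (good m L a)) w.
Proof.
move=> [vnc vs] vb us ts; set eps : R := k.+1%:R^-1.
have eps01 : 0 <= eps <= 1 := invS_gt0_le1 R k.
have /andP[eps0 eps1] := eps01.
have := @thin_mean_close_ge R eps eps01 s (ind (good m L a)) (touches m a) w
  (@ind_ge0 R _).
rewrite (_ : (fun e => touches m a e && (e \in s)) = touches m a); last first.
  by apply/funext => e; case: (boolP (touches m a e)) => // /ts ->.
apply: le_trans; rewrite exprD; apply: ler_pM; rewrite ?exprn_ge0 //.
  apply: ler_wiXn2l => //; rewrite -size_filter -(size_box_edges m.+1 (a.1 - 1, a.2 - 1)).
  apply: uniq_leq_size; first exact: filter_uniq.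
  by move=> e; rewrite mem_filter => /andP[/touches_box_edges].
rewrite -thin_mean_close.
pose N := (L + 4 * m)%N.
pose r i : config -> R := ind (reach N (v i)).
pose r012 w' := r ord0 w' * (r (inord 1) w' * r (inord 2) w').
apply: le_trans (_ : thin_mean eps s r012 w <= _); last first.
  apply: thin_mean_le => // w' sub.
  rewrite /r012 /r -!ind_and; apply: ind_le => -[r0 [r1 r2]].
  apply: (reach_good sub vb vnc) => -[[|[|[|]]] //= i3].
  - by rewrite (_ : Ordinal _ = ord0) //; exact/val_inj.
  - by rewrite (_ : Ordinal _ = inord 1) //; apply/val_inj; rewrite /= inordK.
  - by rewrite (_ : Ordinal _ = inord 2) //; apply/val_inj; rewrite /= inordK.
have inc i : increasing (r i) by exact: ind_reach_increasing.
have inc2 : increasing (fun w' => r (inord 1) w' * r (inord 2) w').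
  by move=> w1 w2 h; apply: ler_pM; rewrite ?ind_ge0 //; exact: inc.
have vsi i : eps <= thin_mean eps s (r i) w by exact: vs.
apply: le_trans (thin_mean_harris eps01 s w (inc ord0) inc2).
rewrite exprS; apply: ler_pM => //; first by rewrite exprn_ge0.
apply: le_trans (thin_mean_harris eps01 s w (inc _) (inc _)).
by rewrite expr2; apply: ler_pM.
Qed.

(** * Counting good boxes in a large square *)

Lemma exit_through (F : set edge) (P : vertex -> bool) x y :
  F_conn F x y -> P x -> ~~ P y ->
  exists z t, [/\ P z, ~~ P t, F_adj F z t &
    F_conn [set e | [/\ F e, P (esrc e) & P (etgt e)]] x z].
Proof.
move=> c; elim: (clos_rt_rt1n _ _ _ _ c) => {x y c} [x ->//|x t y xt _ IH Px Py].
have [Pt|Pt] := boolP (P t); last by exists x, t; split => //; exact: rt_refl.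
have [z [u [Pz Pu zu tz]]] := IH Pt Py.
exists z, u; split => //; apply: rt_trans tz; apply: rt_step.
have [e [Fe h]] := xt; exists e; split => //=.
by case: h => -[-> ->]; split.
Qed.

(** The four sides are listed separately; corners occur twice, which is harmless for an upper
    bound. *)
Definition box_boundary (D : nat) (a : vertex) (q : 'I_4 * 'I_D.+1) : vertex :=
  match val q.1 with
  | 0 => (a.1, a.2 + (q.2 : nat)%:Z)
  | 1 => (a.1 + D%:Z, a.2 + (q.2 : nat)%:Z)
  | 2 => (a.1 + (q.2 : nat)%:Z, a.2)
  | _ => (a.1 + (q.2 : nat)%:Z, a.2 + D%:Z)
  end.

Lemma box_boundary_exit (F : set edge) D a z t :
  inbox D a z -> ~~ inbox D a t -> F_adj F z t -> exists q, z = @box_boundary D a q.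
Proof.
case: a z t => a b [x y] [x' y']; rewrite /inbox /= => zb tb zt.
have {}zt : `|x - x'| + `|y - y'| <= 1.
  have [[[e1 e2] h] [_ h']] := zt; move: h'; rewrite /esrc /etgt /=.
  by case: h => /=; case=> -[[? ?] [? ?]]; lia.
have xD : (absz (x - a) < D.+1)%N by lia.
have yD : (absz (y - b) < D.+1)%N by lia.
have [xa|xa] := eqVneq x a.
  by exists (inord 0, Ordinal yD); rewrite /box_boundary /= inordK //=; congr pair; lia.
have [xaD|xaD] := eqVneq x (a + D%:Z).
  by exists (inord 1, Ordinal yD); rewrite /box_boundary /= inordK //=; congr pair; lia.
have [yb|yb] := eqVneq y b.
  by exists (inord 2, Ordinal xD); rewrite /box_boundary /= inordK //=; congr pair; lia.
by exists (inord 3, Ordinal xD); rewrite /box_boundary /= inordK //=; congr pair; lia.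
Qed.

Definition tile (S : nat) (n : nat) (a : vertex) (p : 'I_n * 'I_n) : vertex :=
  (a.1 + (S * p.1)%N%:Z, a.2 + (S * p.2)%N%:Z).

Lemma tile_disjoint S n a m (p q : 'I_n * 'I_n) v : (m < S)%N ->
  inbox m (tile S a p) v -> inbox m (tile S a q) v -> p = q.
Proof.
case: p q v => [[p p'] [p2 p2']] [[q q'] [q2 q2']] [x y] mS.
rewrite /inbox /tile /= => h1 h2.
have e1 : p = q by nia.
have e2 : p2 = q2 by nia.
by congr pair; apply/val_inj.
Qed.

(** The good tiles form one side of the bipartite graph and labels of clusters meeting the boundary
    of the square the other. Three edges per tile give [3 * #|G| <= 2 * (#|G| + 4 * D.+1)]. *)
Lemma good_count m S n a w : (m < S)%N ->
  (#|[pred p : 'I_n * 'I_n | `[< good m (2 * (S * n).+1) (tile S a p) w >]]|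
    <= 8 * (S * n).+2)%N.
Proof.
move=> mS; set L := (2 * _)%N; set G := [pred p | _].
(* The square leaves a margin of one vertex around the tiles, so it contains the outer ends [c j i].
   Its l1-diameter is [L = 2 * D], so a point farther than [L] from a tile corner lies outside. *)
pose D := (S * n).+1; pose a' : vertex := (a.1 - 1, a.2 - 1).
pose J : finType := {p | p \in G}.
pose inL := inbox D a'.
have tile_in (p : 'I_n * 'I_n) v : inbox m (tile S a p) v ->
    [/\ a.1 <= v.1, v.1 < a.1 + (S * n)%N%:Z, a.2 <= v.2 & v.2 < a.2 + (S * n)%N%:Z].
  case: p v => [[p p'] [p2 p2']] [x y]; rewrite /inbox /tile /= => h.
  have h1 : (S * p.+1 <= S * n)%N by rewrite leq_mul2l p' orbT.
  have h2 : (S * p2.+1 <= S * n)%N by rewrite leq_mul2l p2' orbT.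
  by rewrite !mulnS in h1 h2; split; lia.
pose FL := [set e | [/\ w e, inL (esrc e) & inL (etgt e)]].
pose T (j : J) := tile S a (val j).
have T_good j : good m L (T j) w by apply/asboolP; exact: (valP j).
have T_closed j e : touches m (T j) e -> w e = false.
  by have [h _] := T_good j; move=> /h /negbTE.
pose boxof v : option J := [pick j | inbox m (T j) v].
have boxofP j v : inbox m (T j) v -> boxof v = Some j.
  move=> vj; rewrite /boxof; case: pickP => [j' vj'|/(_ j)]; last by rewrite vj.
  by congr Some; apply/val_inj; apply: tile_disjoint mS vj' vj.
(* A cluster of the square is named by one boundary vertex that it meets; a cluster missing the
   boundary gets no name. *)
pose kof v : option ('I_4 * 'I_D.+1) :=
  [pick q | `[< F_conn FL v (box_boundary a' q) >]].
have kofP v q : kof v = Some q -> F_conn FL v (box_boundary a' q).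
  by rewrite /kof; case: pickP => // q' /asboolP h [<-].
have kof_eq u v : F_conn FL u v -> kof u = kof v.
  move=> uv; apply: eq_pick => q; apply/asboolP/asboolP; last exact: rt_trans.
  by apply: rt_trans; exact: F_conn_sym.
pose comp v : option (J + 'I_4 * 'I_D.+1) :=
  if boxof v is Some j then Some (inl j) else omap inr (kof v).
pose base (h : J + 'I_4 * 'I_D.+1) : vertex :=
  match h with inl j => T j | inr q => box_boundary a' q end.
(* The edges inside a good box are closed in [w] but are included here, so that each box becomes one
   connected node. *)
pose inU e := `[< FL e >] ||
  [exists j : J, inbox m (T j) (esrc e) && inbox m (T j) (etgt e)].
pose U := undup [seq e <- box_edges D a' | inU e].
have UP e : (e \in U) = inU e.
  rewrite mem_undup mem_filter mem_box_edges andbC.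
  case: (boolP (inU e)) => [|_]; last by rewrite andbF.
  rewrite andbT => /orP[/asboolP[]//|/existsP[j /andP[/tile_in[? ? ? ?] _]]].
  by rewrite /inbox /a' /=; lia.
have [c [f cf]] : exists (c : J -> 'I_3 -> vertex) (f : J -> 'I_3 -> edge), forall j,
    (forall i,
      [/\ (inbox m (T j) (esrc (f j i)) /\ etgt (f j i) = c j i) \/
          (inbox m (T j) (etgt (f j i)) /\ esrc (f j i) = c j i),
          ~~ inbox m (T j) (c j i) &
          exists y, L%:Z < dist1 (T j) y /\ F_conn (open_edges w) (c j i) y]) /\
    (forall i i', i != i' -> ~ F_conn (open_edges w) (c j i) (c j i')).
  have h j : exists cf : ('I_3 -> vertex) * ('I_3 -> edge),
    (forall i,
      [/\ (inbox m (T j) (esrc (cf.2 i)) /\ etgt (cf.2 i) = cf.1 i) \/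
          (inbox m (T j) (etgt (cf.2 i)) /\ esrc (cf.2 i) = cf.1 i),
          ~~ inbox m (T j) (cf.1 i) &
          exists y, L%:Z < dist1 (T j) y /\ F_conn (open_edges w) (cf.1 i) y]) /\
    (forall i i', i != i' -> ~ F_conn (open_edges w) (cf.1 i) (cf.1 i')).
    by have [_ [c [f h]]] := T_good j; exists (c, f).
  have [cf cfP] := choice h.
  by exists (fun j => (cf j).1), (fun j => (cf j).2).
have far j y : L%:Z < dist1 (T j) y -> ~~ inL y.
  have [] := tile_in (val j) (T j).
    by rewrite /inbox /T !lexx /= !lerDl.
  rewrite /dist1 /inL /inbox /a' /D /L /=.
  by move: (T j) => [x1 x2]; case: y => y1 y2 /=; lia.
have c_in j i : inL (c j i).
  have [/(_ i) [h _ _] _] := cf j.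
  by case: h => -[/tile_in + <-]; rewrite /inL /inbox /a' /D /etgt /esrc;
    case: (f j i) => -[x y] [] /= []; lia.
have c_kof j i : exists q, kof (c j i) = Some q.
  have [/(_ i) [_ _ [y [/far fy cy]]] _] := cf j.
  have [z [t [zL tL zt cz]]] := exit_through cy (c_in j i) fy.
  have [q zq] := box_boundary_exit zL tL zt.
  rewrite /kof; case: pickP => [q' _|/(_ q)]; first by exists q'.
  by move/asboolPn; case; rewrite -zq.
(* An open edge leaves [c j i], whereas all edges touching a good box are closed. *)
have c_box j i : boxof (c j i) = None.
  rewrite /boxof; case: pickP => // j' cj'.
  have [/(_ i) [_ _ [y [/far fy cy]]] _] := cf j.
  case: (clos_rt_rt1n _ _ _ _ cy) fy => [|z t [e [we h]] _ _].
    by rewrite c_in.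
  move: we; rewrite /open_edges /= (@T_closed j') //.
  by case: h => -[hs ht]; rewrite /touches ?hs ?ht cj' ?orbT.
have [q qP] := choice (fun i : J * 'I_3 => c_kof i.1 i.2).
have := @planar_bipartite (J * 'I_3)%type J ('I_4 * 'I_D.+1)%type
  (fun i => f i.1 i.2) U comp base fst q (undup_uniq _).
move=> planar.
suff : (#|{: J * 'I_3}| <= 2 * (#|J| + #|{: 'I_4 * 'I_D.+1}|))%N.
  have cJ : #|J| = #|G| by rewrite card_sig; apply: eq_card => p; rewrite inE.
  by rewrite !card_prod !card_ord cJ /D; lia.
apply: planar.
(* Two arms of one box with the same label would be connected in [w]. *)
- move=> [j i] [j' i'] /= [-> qq]; congr pair.
  have [_ h] := cf j'; apply: contrapT => /eqP ii; apply: (h _ _ ii).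
  have FLw : FL `<=` open_edges w by move=> e [].
  apply: (F_conn_mono FLw); apply: rt_trans (kofP _ _ (qP (j', i))) _.
  by apply: F_conn_sym; rewrite qq; exact: kofP (qP (j', i')).
- move=> [j i] /=; rewrite /comp.
  have [/(_ i) [h _ _] _] := cf j.
  have qi := qP (j, i); rewrite /= in qi.
  by case: h => -[/boxofP ub uc]; [left|right]; rewrite ub uc c_box qi.
- move=> e; rewrite UP => /orP[/asboolP[we sL tL]|/existsP[j /andP[sj tj]]]; last first.
    by rewrite /comp (boxofP _ _ sj) (boxofP _ _ tj).
  have nb v : v = esrc e \/ v = etgt e -> boxof v = None.
    rewrite /boxof => ve; case: pickP => // j vj.
    rewrite (@T_closed j) // in we.
    by rewrite /touches; case: ve => <-; rewrite vj ?orbT.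
  rewrite /comp !nb; [|by right|by left].
  congr omap; apply: kof_eq; apply: rt_step; exists e; split; last by left.
  by split.
- move=> v h; rewrite /comp; case E: (boxof v) => [j|].
    move=> [<-] /=; apply: (@box_connected _ m).
      move=> e es et; rewrite /= UP; apply/orP; right.
      by apply/existsP; exists j; rewrite es et.
    by move: E; rewrite /boxof; case: pickP => // j' vj' [<-].
  case E' : (kof v) => [k|] //= [<-] /=.
  apply: F_conn_mono (kofP _ _ E') => e eF; rewrite /= UP.
  by apply/orP; left; exact/asboolP.
Qed.

(** * Density of good boxes *)

Definition translate (u v : vertex) : vertex := (v.1 + u.1, v.2 + u.2).

Definition opp_vertex (u : vertex) : vertex := (- u.1, - u.2).

Lemma edge_map_translate u e : edge_map (translate u) e = (translate u e.1, e.2).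
Proof.
case: u e => a b [[x y] []]; rewrite /edge_map /edge_of /translate /esrc /etgt /=.
  rewrite !xpair_eqE /=.
  case: ifP => [h|_]; first by exfalso; move: h; lia.
  case: ifP => [h|_]; first by exfalso; move: h; lia.
  by case: ifP => // h; exfalso; move: h; lia.
by rewrite !xpair_eqE /= addrAC !eqxx.
Qed.

Lemma translateK u v : translate u (translate (opp_vertex u) v) = v.
Proof. by case: u v => a b [x y]; rewrite /translate /= !subrK. Qed.

Lemma translateKV u v : translate (opp_vertex u) (translate u v) = v.
Proof. by case: u v => a b [x y]; rewrite /translate /= !addrK. Qed.

Lemma translate_automorphism u : automorphism (translate u).
Proof.
split; first exact: Bijective (translateKV u) (translateK u).
move=> [x y] [x' y']; rewrite /adj /translate /=.
by case: u => a b /=; lia.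
Qed.

Lemma edge_map_translateK u e :
  edge_map (translate u) (edge_map (translate (opp_vertex u)) e) = e.
Proof. by rewrite !edge_map_translate /= translateK -surjective_pairing. Qed.

Lemma edge_map_translateKV u e :
  edge_map (translate (opp_vertex u)) (edge_map (translate u) e) = e.
Proof. by rewrite !edge_map_translate /= translateKV -surjective_pairing. Qed.

Lemma F_conn_translate u w x y :
  F_conn (open_edges (w \o edge_map (translate u))) x y ->
  F_conn (open_edges w) (translate u x) (translate u y).
Proof.
elim=> {x y} [x y [e [we h]]|x|x y z _ IH _ IH'].
- apply: rt_step; exists (edge_map (translate u) e); split; first exact: we.
  have hs : esrc (edge_map (translate u) e) = translate u (esrc e).
    by rewrite edge_map_translate.
  have ht : etgt (edge_map (translate u) e) = translate u (etgt e).
    rewrite edge_map_translate /etgt /translate /=.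
    by case: (e.2) => /=; congr pair; ring.
  by rewrite hs ht; case: h => -[-> ->]; [left|right].
- exact: rt_refl.
- exact: rt_trans IH IH'.
Qed.

Lemma dist1_translate u x y : dist1 (translate u x) (translate u y) = dist1 x y.
Proof. by case: u x y => a b [x x'] [y y']; rewrite /dist1 /translate /=; lia. Qed.

Lemma encounter_translate (R : realType) k v u w :
  encounter R k v (w \o edge_map (translate u)) ->
  encounter R k (fun i => translate u (v i)) w.
Proof.
move=> [vnc vs]; split=> [i j ij c|i s N us].
  apply: (vnc i j ij); rewrite -(translateKV u (v i)) -(translateKV u (v j)).
  apply: F_conn_translate; rewrite (_ : _ \o _ = w) //.
  by apply/funext => e /=; rewrite edge_map_translateK.
pose s' := map (edge_map (translate (opp_vertex u))) s.
have us' : uniq s' by rewrite map_inj_uniq //; exact: can_inj (edge_map_translateK u).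
apply: le_trans (vs i s' N us') _.
rewrite thin_mean_shift; last exact: can_inj (edge_map_translateKV u).
rewrite -map_comp (@eq_map _ _ _ id) ?map_id; last exact: edge_map_translateK.
apply: thin_mean_le; first exact: invS_gt0_le1.
move=> w' _; apply: ind_le => -[y [far vy]]; exists (translate u y); split.
  by rewrite dist1_translate.
exact: F_conn_translate.
Qed.

Lemma sum_probability_le (R : realType) (d : measure_display)
    (Om : measurableType d) (P : probability Om R) (I : finType)
    (A : I -> set Om) (C : R) :
  (forall i, measurable (A i)) -> (forall o, \sum_i \1_(A i) o <= C) ->
  (\sum_i P (A i) <= C%:E)%E.
Proof.
move=> mA AC.
have -> : (\sum_i P (A i) = \int[P]_o (\sum_(i <- enum I) (\1_(A i) o)%:E))%E.
  rewrite ge0_integral_sum //.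
  - by rewrite big_enum; apply: eq_bigr => i _; rewrite integral_indic // setIT.
  - by move=> i; apply/measurable_EFinP; exact: measurable_indic.
  - by move=> i o _; rewrite lee_fin.
apply: (@le_trans _ _ (\int[P]_o (C%:E))%E); last first.
  rewrite integral_cst // (_ : (_ * _ = C%:E)%E) // -[RHS]mule1.
  by congr (_ * _)%E; exact: probability_setT.
apply: ge0_le_integral => //.
- by move=> o _; apply: sume_ge0 => i _; rewrite lee_fin.
- apply: emeasurable_sum => i; apply/measurable_EFinP; exact: measurable_indic.
- by move=> o _; rewrite sumEFin lee_fin big_enum; exact: AC.
Qed.

(** This holds for each fixed [w]: the thinned mean of the number of good tiles is at least a
    constant times the number of encounters, and [good_count] bounds it pointwise. *)
Lemma encounter_density (R : realType) k m n (v : 'I_3 -> vertex) (a : vertex) w :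
  (forall i, inbox m a (v i)) ->
  (k.+1%:R^-1 : R) ^+ (2 * m.+2 ^ 2 + 3) *
    \sum_(p : 'I_n * 'I_n)
      ind (encounter R k (fun i => translate (tile m.+1 (0, 0) p) (v i))) w
  <= (8 * (m.+1 * n).+2)%:R.
Proof.
move=> vb; set L := (2 * (m.+1 * n).+1)%N; set eps : R := k.+1%:R^-1.
have eps01 : 0 <= eps <= 1 := invS_gt0_le1 R k.
pose t (p : 'I_n * 'I_n) := tile m.+1 a p.
pose s := undup (flatten [seq box_edges m.+1 ((t p).1 - 1, (t p).2 - 1) |
  p <- enum {: 'I_n * 'I_n}]).
have st p e : touches m (t p) e -> e \in s.
  move=> /touches_box_edges h; rewrite mem_undup; apply/flattenP.
  by eexists; last exact: h; apply: map_f; rewrite mem_enum.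
rewrite big_distrr /=.
apply: le_trans (_ : thin_mean eps s
    (fun w' => \sum_(p : 'I_n * 'I_n) ind (good m L (t p)) w') w <= _).
  rewrite thin_mean_sum; apply: ler_sum => p _.
  rewrite {1}/ind; case: asboolP => [enc|_]; last first.
    by rewrite mulr0 thin_mean_ge0 // => w'; exact: ind_ge0.
  rewrite mulr1; apply: encounter_good enc _ (undup_uniq _) (st p) => i.
  move: (vb i); rewrite /inbox /t /tile /translate /=; lia.
rewrite -[leRHS](thin_mean_cst eps s _ w); apply: thin_mean_le => // w' _.
rewrite -natr_sum ler_nat.
apply: leq_trans (good_count n a w' (ltnSn m)).
rewrite -sum1_card [leqRHS]big_mkcond /=; apply: leq_sum => p _.
by rewrite inE; case: asboolP.
Qed.

Theorem theorem1p2 (R : realType) (d : measure_display) (Om : measurableType d)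
    (P : probability Om R) (X : Om -> config) :
  invariant_bond_percolation P X ->
  forall B : set Om, measurable B ->
    B `<=` [set w | more_than_two_robust R (X w)] ->
    P B = 0%E.

Proof.
move=> [mX inv] B mB BX; apply/eqP; apply: contrapT => PB0.
have {}PB0 : (0 < P B)%E by rewrite lt0e measure_ge0 andbT; apply/negP.
(* Finite functions make the index type countable. *)
pose A (kv : nat * {ffun 'I_3 -> vertex}) :=
  [set o | encounter R kv.1 kv.2 (X o)].
have mA kv : measurable (A kv) by exact: measurable_encounter.
have [[k v] /=] : exists kv, (0 < P (A kv))%E.
  apply: (positive_measure_cover mA mB _ PB0) => o /BX.
  move=> /more_than_two_robust_encounter[k [v enc]].
  exists (k, finfun v) => //; rewrite /A /=.
  by rewrite (_ : (fun_of_fin _) = v) //; apply/funext => i; rewrite ffunE.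
set delta := P _ => delta0.
have delta_fin : delta \is a fin_num by exact: fin_num_measure.
(* All coordinates of the three vertices are at most [M] in absolute value, so the box of side
   [2 * M] centred at the origin contains them. *)
pose M := (\sum_i (absz (v i).1 + absz (v i).2))%N.
pose m := (2 * M)%N; pose a : vertex := (- M%:Z, - M%:Z).
have vb i : inbox m a (v i).
  have : (absz (v i).1 + absz (v i).2 <= M)%N by rewrite /M (bigD1 i) //= leq_addr.
  by rewrite /inbox /m /a /=; move: (v i) => [x y] /=; lia.
set c : R := (k.+1%:R^-1) ^+ (2 * m.+2 ^ 2 + 3).
have c0 : 0 < c by rewrite exprn_gt0 // invr_gt0 ltr0n.
have bound n : (n ^ 2)%:R * fine delta <= (8 * (m.+1 * n).+2)%:R / c.
  pose E (p : 'I_n * 'I_n) := [set o | encounter R k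
    (fun i => translate (tile m.+1 (0, 0) p) (v i)) (X o)].
  have mE p : measurable (E p) by exact: measurable_encounter.
  (* Invariance moves the encounter to each tile; an inclusion of events suffices. *)
  have dE p : (delta <= P (E p))%E.
    rewrite /delta (_ : A _ = X @^-1` encounter R k v) //.
    rewrite (inv _ (translate_automorphism (tile m.+1 (0, 0) p))); last first.
      exact: config_measurable_encounter.
    apply: le_measure; rewrite ?inE //.
      apply: (@measurable_encounter R k v _ _ (fun o => X o \o _)) => e.
      exact: mX.
    by move=> o /= /encounter_translate.
  rewrite -lee_fin.
  apply: (@le_trans _ _ (\sum_p P (E p))%E); last first.
    apply: sum_probability_le => // o.
    rewrite ler_pdivlMr // mulrC.
    apply: le_trans (@encounter_density R k m n v a (X o) vb).
    by apply: eq_ler; congr (_ * _).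
  apply: (@le_trans _ _ (\sum_(p : 'I_n * 'I_n) delta)%E); last first.
    by apply: lee_sum => p _; exact: dE.
  rewrite -(fineK delta_fin) sumEFin lee_fin sumr_const card_prod !card_ord.
  by rewrite mulr_natl -mulnn.
have d0 : 0 < fine delta by rewrite fine_gt0 // delta0 /= ltey_eq delta_fin.
(* For [n] at least 1 the linear bound is at most [8 * m.+3 * n]; beyond the threshold [K] the
   quadratic side exceeds it. *)
pose K : R := (8 * m.+3)%:R / (c * fine delta).
pose n := (Num.truncn K).+1.
have Kn : K < n%:R by rewrite /n truncnS_gt.
have := bound n; rewrite ler_pdivlMr // leNgt => /negP; apply.
apply: le_lt_trans (_ : (8 * m.+3 * n)%:R < _).
  rewrite ler_nat /n; nia.
have -> : (n ^ 2)%:R * fine delta * c = n%:R * (n%:R * (c * fine delta)).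
  by rewrite natrX; ring.
rewrite natrM mulrC ltr_pM2l ?ltr0n //.
by have cd0 := mulr_gt0 c0 d0; move: Kn; rewrite /K ltr_pdivrMr.
Qed.
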